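(* Let $B$ be an admissible Banach sequence space over $\mathbb{Z}$, let $X$ be a Banach space, and let $(A_m)_{m\in\mathbb{Z}}$ be a sequence of bounded linear operators on $X$ that admits an exponential dichotomy on $\mathbb Z$. Let $G\colon X_B\to X_B$ be the bounded linear operator that assigns to each $\mathbf y\in X_B$ the unique $\mathbf x=(x_n)_{n\in\mathbb Z}\in X_B$ with $x_{n+1}-A_nx_n=y_{n+1}$ for all $n\in\mathbb Z$. Let $c>0$ and let $f_n\colon X\to X$, $n\in\mathbb{Z}$, be maps such that $\|f_n(x)-f_n(y)\|\le c\|x-y\|$ for all $n\in\mathbb{Z}$ and $x,y\in X$. Assume that $c\,\|G\|<1$. Then the system $x_{n+1}=F_n(x_n)$, $n\in\mathbb Z$, where $F_n:=A_n+f_n$, has the $B$-Lipschitz shadowing property. Furthermore, the trajectory shadowing each pseudotrajectory is unique: for every $\varepsilon>0$, with $\delta=L\varepsilon$ as in the definition of the $B$-Lipschitz shadowing property, and for every $(\delta,B)$-pseudotrajectory $(y_n)_{n\in\mathbb Z}$, there is exactly one sequence $(x_n)_{n\in\mathbb Z}$ satisfying $x_{n+1}=F_n(x_n)$ for all $n\in\mathbb Z$, $(x_n-y_n)_{n\in\mathbb Z}\in X_B$ and $\|(x_n-y_n)_{n\in\mathbb Z}\|_B\le\varepsilon$.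
   Context: **Admissible Banach sequence spaces.** Let $\mathcal S(\mathbb Z)$ be the set of all real sequences $\mathbf s=(s_n)_{n\in\mathbb Z}$. A linear subspace $B\subset\mathcal S(\mathbb Z)$ with a norm $\|\cdot\|_B$ is a normed sequence space if whenever $\mathbf s'\in B$ and $|s_n|\le|s_n'|$ for all $n\in\mathbb Z$, then $\mathbf s\in B$ and $\|\mathbf s\|_B\le\|\mathbf s'\|_B$. If it is complete, it is a Banach sequence space. A Banach sequence space $B$ is admissible if (1) $\chi_{\{n\}}\in B$ and $\|\chi_{\{n\}}\|_B>0$ for all $n\in\mathbb Z$ ($\chi$ denotes the characteristic function); (2) for each $\mathbf s\in B$ and $m\in\mathbb Z$ the shifted sequence $(s_{n+m})_{n\in\mathbb Z}$ belongs to $B$ and has the same norm as $\mathbf s$. It is assumed throughout that $\|\chi_{\{0\}}\|_B=1$. For a Banach space $X$, $X_B$ is the Banach space of sequences $\mathbf x=(x_n)_{n\in\mathbb Z}\subset X$ with $(\|x_n\|)_{n\in\mathbb Z}\in B$, with norm $\|\mathbf x\|_B:=\|(\|x_n\|)_{n\in\mathbb Z}\|_B$. **Exponential dichotomy on $\mathbb Z$.** For $m\ge n$ set $\mathcal A(m,n)=A_{m-1}\cdots A_n$ if $m>n$ and $\mathcal A(m,m)=\mathrm{Id}$. The sequence $(A_m)_{m\in\mathbb Z}$ admits an exponential dichotomy if: (1) there are projections $P_m$, $m\in\mathbb Z$, on $X$ with $P_{m+1}A_m=A_mP_m$ for all $m$; (2) $A_m|_{\ker P_m}\colon\ker P_m\to\ker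 P_{m+1}$ is invertible for all $m$; (3) there exist $C,\lambda>0$ such that $\|\mathcal A(m,n)P_n\|\le Ce^{-\lambda(m-n)}$ for $m\ge n$ and $\|\mathcal A(m,n)(\mathrm{Id}-P_n)\|\le Ce^{-\lambda(n-m)}$ for $m\le n$, where for $m\le n$, $\mathcal A(m,n):=(\mathcal A(n,m)|_{\ker P_m})^{-1}\colon\ker P_n\to\ker P_m$. **The operator $G$.** It is a known fact that when $(A_m)_{m\in\mathbb Z}$ admits an exponential dichotomy, for each $\mathbf y\in X_B$ there is a unique $\mathbf x\in X_B$ with $x_{n+1}-A_nx_n=y_{n+1}$ for all $n\in\mathbb Z$, and $\mathbf x=G\mathbf y$ where $(G\mathbf y)_n=\sum_{m\in\mathbb Z}\mathcal G(n,m+1)y_{m+1}$ with $\mathcal G(n,m)=\mathcal A(n,m)P_m$ for $m\le n$ and $\mathcal G(n,m)=-\mathcal A(n,m)(\mathrm{Id}-P_m)$ for $n<m$. $\|G\|$ denotes the operator norm of $G$ on $X_B$. **Shadowing.** For $\delta>0$, a sequence $(y_n)_{n\in\mathbb Z}\subset X$ is a $(\delta,B)$-pseudotrajectory for $x_{n+1}=F_n(x_n)$ if $(y_{n+1}-F_n(y_n))_{n\in\mathbb Z}\in X_B$ and $\|(y_{n+1}-F_n(y_n))_{n\in\mathbb Z}\|_B\le\delta$. The system has the $B$-Lipschitz shadowing property if there is $L>0$ such that for every $\varepsilon>0$, with $\delta=L\varepsilon$, for every $(\delta,B)$-pseudotrajectory $(y_n)_{n\in\mathbb Z}$ there is a sequence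 $(x_n)_{n\in\mathbb Z}$ with $x_{n+1}=F_n(x_n)$ for all $n\in\mathbb Z$, $(x_n-y_n)_{n\in\mathbb Z}\in X_B$ and $\|(x_n-y_n)_{n\in\mathbb Z}\|_B\le\varepsilon$. *)

(* Defs.v *)
From HB Require Import structures.
From mathcomp Require Import all_boot all_order all_algebra.
From mathcomp Require Import all_classical all_reals all_analysis.

Set Implicit Arguments.
Unset Strict Implicit.
Unset Printing Implicit Defensive.

Import Order.TTheory GRing.Theory Num.Theory.
Import numFieldNormedType.Exports.

Local Open Scope classical_set_scope.
Local Open Scope ring_scope.

(* A set of real sequences together with a function meant to be its norm;
   only the values of [seq_norm] on [seq_set] are ever constrained or used. *)
Record seq_space (R : realType) := SeqSpace {
  seq_set :> (int -> R) -> Prop;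
  seq_norm : (int -> R) -> R
}.

Record normed_seq_space (R : realType) (B : seq_space R) : Prop := {
  seq_set0 : B 0;
  seq_setD : forall s t : int -> R, B s -> B t -> B (s + t);
  seq_setZ : forall (a : R) (s : int -> R), B s -> B (a *: s);
  seq_norm_ge0 : forall s, B s -> 0 <= seq_norm B s;
  seq_norm_eq0 : forall s, B s -> seq_norm B s = 0 -> s = 0;
  seq_normZ : forall (a : R) (s : int -> R),
    B s -> seq_norm B (a *: s) = `|a| * seq_norm B s;
  seq_normD : forall s t : int -> R,
    B s -> B t -> seq_norm B (s + t) <= seq_norm B s + seq_norm B t;
  seq_solid : forall s s' : int -> R,
    B s' -> (forall n, `|s n| <= `|s' n|) ->
    B s /\ seq_norm B s <= seq_norm B s'
}.

Definition seq_space_complete (R : realType) (B : seq_space R) : Prop :=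
  forall u : nat -> int -> R,
    (forall k, B (u k)) ->
    (forall e : R, 0 < e ->
      exists N : nat, forall k l : nat, (N <= k)%N -> (N <= l)%N ->
        seq_norm B (u k - u l) < e) ->
    exists2 s : int -> R,
      B s & (fun k => seq_norm B (u k - s)) @ \oo --> (0 : R).

Definition banach_seq_space (R : realType) (B : seq_space R) : Prop :=
  normed_seq_space B /\ seq_space_complete B.

Record admissible (R : realType) (B : seq_space R) : Prop := {
  admissible_banach : banach_seq_space B;
  admissible_chi : forall n : int,
    B (\1_[set n]) /\ 0 < seq_norm B (\1_[set n]);
  admissible_shift : forall (s : int -> R) (m : int), B s ->
    B (fun n => s (n + m)) /\ seq_norm B (fun n => s (n + m)) = seq_norm B s
}.

Section Shadowing.
Context {R : realType}.

Definition normseq (X : normedModType R) (x : int -> X) : int -> R :=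
  fun n => `|x n|.

Definition XB (B : seq_space R) (X : normedModType R) : set (int -> X) :=
  [set x | B (normseq x)].

Definition normXB (B : seq_space R) (X : normedModType R) (x : int -> X) : R :=
  seq_norm B (normseq x).

(* Operator norm of a linear map T of the space D normed by nm; it is
   extended-real valued, so that it equals +oo when T is unbounded. *)
Definition opnorm (V : Type) (D : set V) (nm : V -> R) (T : V -> V) : \bar R :=
  ereal_sup [set (nm (T x))%:E | x in [set x | D x /\ nm x <= 1]].

Definition opnormX (X : normedModType R) (T : X -> X) : \bar R :=
  opnorm setT (fun x : X => `|x|) T.

Definition opnormXB (B : seq_space R) (X : normedModType R)
    (T : (int -> X) -> int -> X) : \bar R :=
  opnorm (@XB B X) (@normXB B X) T.

(* A_(n + k - 1) \o ... \o A_n *)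
Fixpoint iter_op (X : Type) (A : int -> X -> X) (n : int) (k : nat) (x : X) : X :=
  if k is k'.+1 then A (n + k'%:Z) (iter_op A n k' x) else x.

(* The operator A(m, n) for n <= m; junk when m < n. *)
Definition fwd_cocycle (X : Type) (A : int -> X -> X) (m n : int) (x : X) : X :=
  iter_op A n `|m - n|%N x.

Definition kerop (X : normedModType R) (T : X -> X) : set X :=
  [set x | T x = 0].

(* The operator A(m, n) : ker P_n -> ker P_m for m <= n, i.e. the inverse of the
   restriction of A(n, m) to ker P_m. *)
Definition bwd_cocycle (X : normedModType R) (A P : int -> X -> X)
    (m n : int) : X -> X :=
  'pinv_(fun=> 0) (kerop (P m)) (fwd_cocycle A n m).

Definition exp_dichotomy (X : normedModType R) (A : int -> {linear X -> X}) :
    Prop :=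
  exists P : int -> {linear X -> X},
    [/\ forall m x, P m (P m x) = P m x,
        forall m x, P (m + 1) (A m x) = A m (P m x),
        forall m, set_bij (kerop (P m)) (kerop (P (m + 1))) (A m) &
        exists C lambda : R, [/\ 0 < C, 0 < lambda,
          forall m n : int, n <= m ->
            (opnormX (fun x => fwd_cocycle A m n (P n x))
              <= (C * expR (- lambda * (m - n)%:~R))%R%:E)%E &
          forall m n : int, m <= n ->
            (opnormX (fun x => bwd_cocycle A P m n (x - P n x)%R)
              <= (C * expR (- lambda * (n - m)%:~R))%R%:E)%E]].

(* The operator G sending y in X_B to the unique x in X_B such that
   x_(n+1) - A_n x_n = y_(n+1); such an x exists and is unique when A has an
   exponential dichotomy and B is admissible, and 0 is a default value used
   only if there is none. *)
Definition green_op (B : seq_space R) (X : normedModType R)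
    (A : int -> X -> X) (y : int -> X) : int -> X :=
  xget (fun=> 0)
    [set x | XB B x /\ forall n, x (n + 1) - A n (x n) = y (n + 1)].

Definition trajectory (X : Type) (F : int -> X -> X) (x : int -> X) : Prop :=
  forall n, x (n + 1) = F n (x n).

Definition pseudotrajectory (B : seq_space R) (X : normedModType R)
    (F : int -> X -> X) (delta : R) (y : int -> X) : Prop :=
  XB B (fun n => y (n + 1) - F n (y n)) /\
  normXB B (fun n => y (n + 1) - F n (y n)) <= delta.

Definition shadows (B : seq_space R) (X : normedModType R)
    (F : int -> X -> X) (eps : R) (y x : int -> X) : Prop :=
  [/\ trajectory F x,
      XB B (fun n => x n - y n) &
      normXB B (fun n => x n - y n) <= eps].

Definition shadowing_constant (B : seq_space R) (X : normedModType R)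
    (F : int -> X -> X) (L : R) : Prop :=
  0 < L /\
  forall eps : R, 0 < eps ->
    forall y : int -> X, pseudotrajectory B F (L * eps) y ->
      exists x : int -> X, shadows B F eps y x.

Definition lipschitz_shadowing (B : seq_space R) (X : normedModType R)
    (F : int -> X -> X) : Prop :=
  exists L : R, shadowing_constant B F L.

End Shadowing.

(* Main.v *)
Require Import Defs.
From mathcomp Require Import all_boot all_order all_algebra.
From mathcomp Require Import ring zify.
From mathcomp Require Import all_classical all_reals all_analysis.

Import Order.TTheory GRing.Theory Num.Theory.
Import numFieldNormedType.Exports.

Local Open Scope classical_set_scope.
Local Open Scope ring_scope.

Set Implicit Arguments.
Unset Strict Implicit.
Unset Printing Implicit Defensive.

(** Write [y] for a pseudotrajectory, [e n = y (n + 1) - F n (y n)] for its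
    error and [x = y + z] for a candidate trajectory. Then [x] is a trajectory
    exactly when
      [z (n + 1) - A n (z n) = f n (y n + z n) - f n (y n) - e n],
    that is, when [z] is a fixed point of the map that applies the Green
    operator [G] to the right-hand side, moved by one index. The Lipschitz
    condition on [f] and the shift invariance and solidity of [B] make this map
    a contraction of [X_B] of ratio [c * g], where [g < 1 / c] bounds the norm
    of [G]. Its fixed point is the shadowing trajectory, and the linear estimate
    behind the contraction also gives
      [(1 - c * g) * ||x - y|| <= g * ||e||]
    for every trajectory [x] with [x - y] in [X_B] ([shadowing_estimate]), from
    which a Lipschitz constant is read off. Applied to two trajectories, with
    error zero, the same estimate gives uniqueness, whatever the constant.

    Two points need more than this computation.

    First, [G] is defined by a choice among solutions, so that it means
    something only once the inhomogeneous linear equation is known to have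
    exactly one solution in [X_B]. Existence ([dichotomy_solution]): sum the
    images of the stable components of the past of [y] and subtract the
    backward images of the unstable components of its future; the dichotomy
    makes both series geometric in [X_B]. Uniqueness
    ([bounded_trajectory_eq0]): elements of [X_B] are bounded, and a bounded
    trajectory of the linear system has zero stable part, being the image of
    its distant past, and zero unstable part, being the backward image of its
    distant future.

    Secondly, limits are needed in [X_B] both for these series and for the
    Picard iteration. A series of geometrically decreasing norm has termwise
    limits whose norms are dominated by the sum in [B] of the norms of the
    terms ([XB_geometric_series]). Knowing that the limit exists at each index
    and lies in [X_B] is enough, because all equations to be passed to the limit
    relate finitely many indices through continuous maps. *)

(** * Norms and series in the sequence spaces *)

Section SequenceSpaces.
Context {R : realType} (B : seq_space R).
Hypothesis hB : admissible B.

Let nB : normed_seq_space B := (admissible_banach hB).1.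

(** Solidity of [B], in the form that turns a pointwise bound into membership
    in [X_B]. *)
Lemma XB_dominated (X : normedModType R) (x : int -> X) (s : int -> R) :
  B s -> (forall n, `|x n| <= s n) -> XB B x /\ normXB B x <= seq_norm B s.
Proof.
move=> Bs xs; apply: (seq_solid nB Bs) => n.
by rewrite normr_id (le_trans (xs n))// ler_norm.
Qed.

Lemma XB_le (X Y : normedModType R) (a : R) (x : int -> X) (y : int -> Y) :
  0 <= a -> XB B y -> (forall n, `|x n| <= a * `|y n|) ->
  XB B x /\ normXB B x <= a * normXB B y.
Proof.
move=> a0 By xy.
have [Bx xle] := XB_dominated (seq_setZ nB a By) xy.
by split=> //; rewrite (le_trans xle)// (seq_normZ nB)// ger0_norm.
Qed.

Lemma normXB_ge0 (X : normedModType R) (x : int -> X) :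
  XB B x -> 0 <= normXB B x.
Proof. exact: seq_norm_ge0. Qed.

Lemma XB0 (X : normedModType R) : XB B (fun=> 0 : X).
Proof.
apply: (XB_dominated (seq_set0 nB) _).1 => n.
by rewrite normr0.
Qed.

Lemma XBD (X : normedModType R) (x y : int -> X) : XB B x -> XB B y ->
  XB B (fun n => x n + y n) /\
  normXB B (fun n => x n + y n) <= normXB B x + normXB B y.
Proof.
move=> Bx By.
have [Bxy le_xy] : XB B (fun n => x n + y n) /\
    normXB B (fun n => x n + y n) <= seq_norm B (normseq x + normseq y).
  by apply: XB_dominated => [|n]; [exact: seq_setD | exact: ler_normD].
by split=> //; rewrite (le_trans le_xy)// (seq_normD nB).
Qed.

Lemma XBZ (X : normedModType R) (a : R) (x : int -> X) : XB B x ->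
  XB B (fun n => a *: x n) /\
  normXB B (fun n => a *: x n) = `|a| * normXB B x.
Proof.
move=> Bx; rewrite /normXB /XB /=.
have -> : normseq (fun n => a *: x n) = `|a| *: normseq x.
  by apply/funext => n; rewrite /normseq normrZ.
by split; [exact: seq_setZ | rewrite (seq_normZ nB)// normr_id].
Qed.

Lemma XBB (X : normedModType R) (x y : int -> X) : XB B x -> XB B y ->
  XB B (fun n => x n - y n) /\
  normXB B (fun n => x n - y n) <= normXB B x + normXB B y.
Proof.
move=> Bx By; suff [BNy <-] : XB B (fun n => - y n) /\
    normXB B (fun n => - y n) = normXB B y by exact: XBD.
have -> : (fun n => - y n) = (fun n => -1 *: y n).
  by apply/funext => n; rewrite scaleN1r.
by have [? ->] := XBZ (-1) By; rewrite normrN1 mul1r.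
Qed.

Lemma XB_shift (X : normedModType R) (m : int) (x : int -> X) : XB B x ->
  XB B (fun n => x (n + m)) /\ normXB B (fun n => x (n + m)) = normXB B x.
Proof. exact: admissible_shift. Qed.

Lemma normXB_eq0 (X : normedModType R) (x : int -> X) : XB B x ->
  normXB B x = 0 -> forall n, x n = 0.
Proof.
move=> Bx /(seq_norm_eq0 nB Bx) /(congr1 (fun s => s _)) x0 n.
by apply/normr0_eq0; exact: x0.
Qed.

Hypothesis hB1 : seq_norm B (\1_[set (0 : int)]) = 1.

(** Shift invariance gives all the unit sequences norm 1, and
    [`|s n| *: \1_[set n]] is dominated by [s]: so evaluations are contractions,
    and convergence in [B] implies termwise convergence. *)
Lemma seq_norm_eval (s : int -> R) n : B s -> `|s n| <= seq_norm B s.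
Proof.
move=> Bs.
have chi_n : seq_norm B (\1_[set n]) = 1.
  rewrite -hB1 -(admissible_shift hB (- n) (admissible_chi hB 0).1).2.
  congr (seq_norm B _); apply/funext => k.
  by rewrite !indicE !in_set1 subr_eq0.
have [||_] := @seq_solid _ _ nB (`|s n| *: \1_[set n]) s => //.
  move=> k; have -> : (`|s n| *: \1_[set n]) k = `|s n| * \1_[set n] k by [].
  rewrite indicE in_set1.
  by case: eqP => [->|_]; rewrite ?mulr1 ?normr_id// mulr0 normr0.
rewrite (seq_normZ nB) ?chi_n ?normr_id ?mulr1//.
exact: (admissible_chi hB n).1.
Qed.

Lemma normXB_eval (X : normedModType R) (x : int -> X) n : XB B x ->
  `|x n| <= normXB B x.
Proof. by move=> Bx; rewrite -[leLHS]normr_id; exact: (seq_norm_eval n Bx). Qed.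

(** The telescoped form of the geometric bound, which is what makes the
    induction on [d] close. *)
Let partial_sum_dist (X : normedModType R) (u : nat -> int -> X) (K r : R)
    (r1 : r < 1)
    (uK : forall k, XB B (u k) /\ normXB B (u k) <= K * r ^+ k) (k d : nat) :
  let s k := fun n => \sum_(0 <= j < k) `|u j n| in
  B (s (k + d)%N - s k) /\
  seq_norm B (s (k + d)%N - s k) <= K * (r ^+ k - r ^+ (k + d)) / (1 - r).
Proof.
move=> s; elim: d => [|d [IH1 IH2]].
  rewrite addn0 !subrr mulr0 mul0r; split; first exact: seq_set0 nB.
  have := seq_normZ nB 0 (seq_set0 nB).
  by rewrite scale0r normr0 mul0r => ->.
have -> : s (k + d.+1)%N - s k = s (k + d)%N - s k + normseq (u (k + d)%N).
  apply/funext => n; rewrite !fctE /s addnS big_nat_recr//= /normseq.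
  by rewrite addrAC.
have [Bu ule] := uK (k + d)%N.
split; first exact: seq_setD.
rewrite (le_trans (seq_normD nB _ _))// (le_trans (lerD IH2 ule))//.
rewrite addnS exprS le_eqVlt; apply/orP; left; apply/eqP; field.
by rewrite subr_eq0 gt_eqF.
Qed.

(** The real series of the norms converges in [B] to some [t], because [B] is
    complete. At each index [t] bounds the partial sums of the norms, so the
    series in [X] converges absolutely there, with a sum of norm at most [t]. *)
Lemma XB_geometric_series (X : completeNormedModType R)
    (u : nat -> int -> X) (K r : R) :
  0 <= r < 1 ->
  (forall k, XB B (u k) /\ normXB B (u k) <= K * r ^+ k) ->
  exists2 x, XB B x &
    forall n, (\sum_(0 <= k < N) u k n) @[N --> \oo] --> x n.
Proof.
move=> /andP[r0 r1] uK; have r1' : 0 < 1 - r by rewrite subr_gt0.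
have K0 : 0 <= K.
  have [Bu0] := uK 0%N; rewrite expr0 mulr1; apply: le_trans.
  exact: normXB_ge0.
pose s k := fun n => \sum_(0 <= j < k) `|u j n|.
have Bs k : B (s k).
  have := (partial_sum_dist r1 uK 0 k).1.
  rewrite add0n; congr (seq_set B _); apply/funext => n.
  by rewrite !fctE [X in _ - X]big_geq// subr0.
have [|t Bt st] := (admissible_banach hB).2 s Bs.
  move=> e e0.
  have /cvgrPdist_lt/(_ e e0) :
      geometric (K / (1 - r)) r k @[k --> \oo] --> (0 : R).
    by apply: cvg_geometric; rewrite ger0_norm.
  case=> N _ Ne; exists N.
  suff key : forall k d, (N <= k)%N -> seq_norm B (s (k + d)%N - s k) < e.
    move=> k l Nk Nl; have [kl|/ltnW lk] := leqP k l; last first.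
      by rewrite -(subnKC lk) key.
    have -> : s k - s l = -1 *: (s l - s k) by rewrite scaleN1r opprB.
    have BB : B (s l - s k).
      by have := (partial_sum_dist r1 uK k (l - k)).1; rewrite subnKC.
    by rewrite (seq_normZ nB)// normrN1 mul1r -(subnKC kl) key.
  move=> k d Nk; apply: le_lt_trans (partial_sum_dist r1 uK k d).2 _.
  have := Ne k Nk; rewrite /= sub0r normrN; apply: le_lt_trans.
  apply: le_trans (ler_norm _).
  rewrite [leLHS]mulrAC; apply: ler_wpM2l; first by rewrite divr_ge0// ltW.
  by rewrite gerBl exprn_ge0.
have st_pt n : (s k n) @[k --> \oo] --> t n.
  apply/cvgrPdist_le => e e0.
  move/cvgrPdist_le : st => /(_ e e0); apply: filterS => k.
  have Bd : B (s k - t).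
    rewrite -scaleN1r; apply: seq_setD => //; exact: seq_setZ.
  rewrite sub0r normrN ger0_norm ?(seq_norm_ge0 nB)//; apply: le_trans.
  rewrite distrC.
  exact: (seq_norm_eval n Bd).
have s_nd n : {homo (fun k => s k n) : k l / (k <= l)%N >-> k <= l}.
  by move=> k l kl; rewrite /s (big_cat_nat _ kl)//= lerDl sumr_ge0.
have st_le n k : s k n <= t n.
  rewrite -(cvg_lim _ (st_pt n))//; apply: (nondecreasing_cvgn_le (s_nd n)).
  by apply/cvg_ex; exists (t n); exact: st_pt.
have u_cvg n : cvgn (series (fun k => u k n)).
  by apply: normed_cvg; apply/cvg_ex; exists (t n); exact: st_pt.
exists (fun n => limn (series (fun k => u k n))); last first.
  by move=> n; exact: u_cvg.
apply: (XB_dominated Bt _).1 => n.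
have /cvg_norm u_cvg' := u_cvg n.
rewrite -(cvg_lim _ u_cvg')//; apply: limr_le.
  by apply/cvg_ex; eexists; exact: u_cvg'.
near=> k; apply: le_trans (st_le n k).
exact: ler_norm_sum.
Unshelve. all: by end_near.
Qed.

End SequenceSpaces.

(** * Operator norms and limits *)

Section OperatorNorm.
Context {R : realType}.

(** A general domain [D], as the bound is used both for maps of [X] and for the
    Green operator on [X_B]. Only homogeneity is asked: the inverse cocycle and
    the Green operator are given by choices, so that their linearity is not
    free. *)
Lemma opnorm_bound (V : lmodType R) (D : set V) (nm : V -> R) (T : V -> V)
    (K : R) (x : V) :
  (forall a v, D v -> D (a *: v) /\ nm (a *: v) = `|a| * nm v) ->
  (forall v, D v -> nm v = 0 -> v = 0) ->
  (forall v, D v -> 0 <= nm v) ->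
  (forall v, D v -> D (T v)) ->
  (forall a v, D v -> T (a *: v) = a *: T v) ->
  (opnorm D nm T <= K%:E)%E -> D x -> nm (T x) <= K * nm x.
Proof.
move=> nmZ nm0 nm_ge0 DT TZ TK Dx.
have [x0|xn0] := eqVneq (nm x) 0.
  rewrite x0 mulr0 (nm0 _ Dx x0) -(scale0r x) TZ//.
  by rewrite (nmZ _ _ (DT _ Dx)).2 normr0 mul0r.
have x_gt0 : 0 < nm x by rewrite lt_neqAle eq_sym xn0 nm_ge0.
have [Du nmu] := nmZ (nm x)^-1 x Dx.
have : ((nm (T ((nm x)^-1 *: x)))%:E <= opnorm D nm T)%E.
  apply: ereal_sup_ubound; exists ((nm x)^-1 *: x) => //; split=> //.
  by rewrite nmu gtr0_norm ?invr_gt0// mulVf.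
move=> /le_trans/(_ TK); rewrite lee_fin TZ// (nmZ _ _ (DT _ Dx)).2.
by rewrite gtr0_norm ?invr_gt0// mulrC ler_pdivrMr.
Qed.

Lemma opnorm_fin (V : Type) (D : set V) (nm : V -> R) (T : V -> V) :
  (opnorm D nm T < +oo)%E -> exists K : R, (opnorm D nm T <= K%:E)%E.
Proof.
case: (opnorm D nm T) => [K _| |_]; [by exists K | by rewrite ltxx |].
by exists 0; rewrite leNye.
Qed.

Lemma opnormX_bound (X : normedModType R) (T : X -> X) (K : R) (x : X) :
  (forall a v, T (a *: v) = a *: T v) ->
  (opnormX T <= K%:E)%E -> `|T x| <= K * `|x|.
Proof.
move=> TZ TK; apply: (opnorm_bound (D := setT)) TK _ => //.
- by move=> a v _; split; [|exact: normrZ].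
- by move=> v _ /normr0_eq0.
Qed.

Lemma lipschitz_cvg (X : normedModType R) (g : X -> X) (K : R)
    (u : nat -> X) (x : X) :
  (forall y z, `|g y - g z| <= K * `|y - z|) ->
  u k @[k --> \oo] --> x -> g (u k) @[k --> \oo] --> g x.
Proof.
move=> gK /cvgrPdist_le ux; apply/cvgrPdist_le => e e0.
have K0 : 0 < `|K| + 1 by rewrite ltr_wpDl.
apply: filterS (ux (e / (`|K| + 1)) (divr_gt0 e0 K0)) => k.
rewrite ler_pdivlMr// => le_e; apply: le_trans (gK _ _) _.
apply: le_trans le_e; rewrite mulrC ler_wpM2l//.
by rewrite (le_trans (ler_norm K))// lerDl.
Qed.

Lemma opnormX_cvg (X : normedModType R) (T : {linear X -> X})
    (u : nat -> X) (x : X) : (opnormX T < +oo)%E ->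
  u k @[k --> \oo] --> x -> T (u k) @[k --> \oo] --> T x.
Proof.
move=> /opnorm_fin[K TK]; apply: (@lipschitz_cvg _ _ K) => y z.
by rewrite -linearB; apply: opnormX_bound TK => a v; rewrite linearZ.
Qed.

Lemma geometric_bound_eq0 (X : normedModType R) (v : X) (K r : R) :
  0 <= r < 1 -> (forall k : nat, `|v| <= K * r ^+ k) -> v = 0.
Proof.
move=> /andP[r0 r1] vK; apply/eqP; rewrite -normr_le0 leNgt; apply/negP => v0.
have /cvgrPdist_lt/(_ _ v0) : geometric K r k @[k --> \oo] --> (0 : R).
  by apply: cvg_geometric; rewrite ger0_norm.
case=> N _ /(_ N (leqnn N)); rewrite /= sub0r normrN ltNge.
by rewrite (le_trans (vK N))// ler_norm.
Qed.

End OperatorNorm.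

(** * The linear equation under an exponential dichotomy *)

Section Dichotomy.
Context {R : realType} (X : completeNormedModType R).
Context (A P : int -> {linear X -> X}) (C lambda : R).
Hypothesis hA : forall m, (opnormX (A m) < +oo)%E.
Hypothesis PP : forall m x, P m (P m x) = P m x.
Hypothesis PA : forall m x, P (m + 1) (A m x) = A m (P m x).
Hypothesis kerA : forall m, set_bij (kerop (P m)) (kerop (P (m + 1))) (A m).
Hypotheses (C0 : 0 < C) (lambda0 : 0 < lambda).
Hypothesis fwdC : forall m n : int, n <= m ->
  (opnormX (fun x => fwd_cocycle A m n (P n x))
    <= (C * expR (- lambda * (m - n)%:~R))%R%:E)%E.
Hypothesis bwdC : forall m n : int, m <= n ->
  (opnormX (fun x => bwd_cocycle A P m n (x - P n x)%R)
    <= (C * expR (- lambda * (n - m)%:~R))%R%:E)%E.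

Let r := expR (- lambda).

Let r01 : 0 <= r < 1.
Proof. by rewrite expR_ge0/= -expR0 ltr_expR oppr_lt0. Qed.

Let fwd_cocycleE n (k : nat) x : fwd_cocycle A (n + k%:Z) n x = iter_op A n k x.
Proof. by rewrite /fwd_cocycle addrAC subrr add0r. Qed.

Lemma iter_opZ n k a x : iter_op A n k (a *: x) = a *: iter_op A n k x.
Proof. by elim: k => //= k ->; rewrite linearZ. Qed.

Lemma iter_opSr n k x : iter_op A n k.+1 x = iter_op A (n + 1) k (A n x).
Proof.
elim: k => [|k IH]; first by rewrite /= addr0.
rewrite [LHS]/= -/(iter_op A n k.+1 x) IH /=.
by congr (A _ _); lia.
Qed.

Lemma trajectory_iter_op (x : int -> X) n k : trajectory A x ->
  iter_op A n k (x n) = x (n + k%:Z).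
Proof.
move=> Ax; elim: k => [|k IH] /=; first by rewrite addr0.
by rewrite IH -Ax; congr x; lia.
Qed.

Lemma kerop_compl n y : kerop (P n) (y - P n y).
Proof. by rewrite /kerop/= linearB PP subrr. Qed.

Lemma iter_op_ker n k :
  set_bij (kerop (P n)) (kerop (P (n + k%:Z))) (iter_op A n k).
Proof.
elim: k => [|k IH]; first by rewrite addr0; split=> //= x ?; exists x.
have -> : n + k.+1%:Z = n + k%:Z + 1 by lia.
exact: set_bij_comp IH (kerA (n + k%:Z)).
Qed.

(** Step counts replace pairs of indices, so that the range condition of
    the inverse cocycle holds by construction. *)
Let bwd n (k : nat) y := bwd_cocycle A P n (n + k%:Z) y.

Let bwd_unique n k y x : kerop (P n) x -> iter_op A n k x = y -> bwd n k y = x.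
Proof.
move=> Px <-; rewrite /bwd /bwd_cocycle -fwd_cocycleE.
have [_ inj _] := iter_op_ker n k; rewrite pinvKV ?inE// => u v ? ?.
by rewrite !fwd_cocycleE; exact: inj.
Qed.

Let bwd_spec n k y : kerop (P (n + k%:Z)) y ->
  kerop (P n) (bwd n k y) /\ iter_op A n k (bwd n k y) = y.
Proof.
have [_ _ surj] := iter_op_ker n k => /surj[x Px xy].
by rewrite (bwd_unique Px xy).
Qed.

Let bwdZ n k a y : kerop (P (n + k%:Z)) y -> bwd n k (a *: y) = a *: bwd n k y.
Proof.
move=> /bwd_spec[Px xy]; apply: bwd_unique; last by rewrite iter_opZ xy.
by move: Px; rewrite /kerop/= linearZ/= => ->; rewrite scaler0.
Qed.

Let fwd_bound n k x : `|iter_op A n k (P n x)| <= C * r ^+ k * `|x|.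
Proof.
have := @fwdC (n + k%:Z) n; rewrite lerDl => /(_ isT).
have -> : n + k%:Z - n = k%:Z by lia.
rewrite expRM_natr -/r => /opnormX_bound; rewrite -fwd_cocycleE; apply.
by move=> a v; rewrite linearZ !fwd_cocycleE iter_opZ.
Qed.

Let bwd_bound n k x :
  `|bwd n k (x - P (n + k%:Z) x)| <= C * r ^+ k * `|x|.
Proof.
have := @bwdC n (n + k%:Z); rewrite lerDl => /(_ isT).
have -> : n + k%:Z - n = k%:Z by lia.
rewrite expRM_natr -/r => /opnormX_bound; apply.
by move=> a v; rewrite linearZ/= -scalerBr; apply: bwdZ; exact: kerop_compl.
Qed.

(** The stable part at [n] is the image of the one at [n - k], and the unstable
    part is the backward image of the one at [n + k]; both are at most
    [C * M * r ^+ k] for every [k]. *)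
Lemma bounded_trajectory_eq0 (x : int -> X) (M : R) : trajectory A x ->
  (forall n, `|x n| <= M) -> forall n, x n = 0.
Proof.
move=> Ax xM n.
have APx : trajectory A (fun n => P n (x n)) by move=> m; rewrite Ax PA.
have AQx : trajectory A (fun n => x n - P n (x n)).
  by move=> m; rewrite linearB /= -Ax -PA -Ax.
have Cr_ge0 k : 0 <= C * r ^+ k.
  by rewrite mulr_ge0 ?exprn_ge0 ?(ltW C0)//; case/andP: r01.
have Px0 : P n (x n) = 0.
  apply: (geometric_bound_eq0 (K := C * M) r01) => k.
  have := trajectory_iter_op (n - k%:Z) k APx.
  rewrite subrK => <-; apply: le_trans (fwd_bound _ _ _) _.
  by rewrite [leRHS]mulrAC ler_wpM2l.
have Qx0 : x n - P n (x n) = 0.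
  apply: (geometric_bound_eq0 (K := C * M) r01) => k.
  rewrite -(bwd_unique (kerop_compl n (x n)) (trajectory_iter_op n k AQx)).
  by apply: le_trans (bwd_bound _ _ _) _; rewrite [leRHS]mulrAC ler_wpM2l.
by rewrite -[x n](subrK (P n (x n))) Qx0 Px0 addr0.
Qed.

Context (B : seq_space R).
Hypothesis hB : admissible B.
Hypothesis hB1 : seq_norm B (\1_[set (0 : int)]) = 1.

(** The solution is the series of [A(n, n - k) P y_(n - k)] over [k >= 0];
    [A n] sends its [k]-th term at [n] to the term of rank [k + 1] at [n + 1],
    so only the term of rank 0 at [n + 1] is left over. *)
Lemma stable_solution (y : int -> X) : XB B y ->
  exists2 x, XB B x & forall n, x (n + 1) = A n (x n) + P (n + 1) (y (n + 1)).
Proof.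
move=> By.
pose u (k : nat) n := iter_op A (n - k%:Z) k (P (n - k%:Z) (y (n - k%:Z))).
have [k|x Bx ux] := XB_geometric_series hB hB1 (u := u)
    (K := C * normXB B y) r01.
  have [By' <-] := XB_shift hB (- k%:Z) By; rewrite mulrAC.
  apply: XB_le => //; last by move=> n; exact: fwd_bound.
  by rewrite mulr_ge0 ?exprn_ge0 ?(ltW C0)//; case/andP: r01.
exists x => // n.
have sumS N : \sum_(0 <= k < N.+1) u k (n + 1) =
    A n (\sum_(0 <= k < N) u k n) + P (n + 1) (y (n + 1)).
  rewrite big_nat_recl// {1}/u /= subr0 addrC linear_sum; congr (_ + _).
  apply: eq_bigr => k _; rewrite /u.
  have -> : n + 1 - k.+1%:Z = n - k%:Z by lia.
  by rewrite /= subrK.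
have lhs := ux (n + 1); rewrite -cvg_shiftS /= (funext sumS) in lhs.
apply: norm_cvg_unique lhs _.
by apply: cvgD; [exact: opnormX_cvg (ux n) | exact: cvg_cst].
Qed.

(** The solution is the series of [A(n, n + k) (Id - P) y_(n + k)] over
    [k >= 1]; here [A n] lowers the rank of a term by one, and the left-over
    term is the image of the first one. *)
Lemma unstable_solution (y : int -> X) : XB B y ->
  exists2 x, XB B x &
    forall n, A n (x n) = x (n + 1) + (y (n + 1) - P (n + 1) (y (n + 1))).
Proof.
move=> By.
pose v (k : nat) n := bwd n k (y (n + k%:Z) - P (n + k%:Z) (y (n + k%:Z))).
have v_ker k n : kerop (P n) (v k n) by exact: (bwd_spec (kerop_compl _ _)).1.
have Av k n : A n (v k.+1 n) = v k (n + 1).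
  have [Pv vE] := bwd_spec (kerop_compl (n + k.+1%:Z) (y (n + k.+1%:Z))).
  apply/esym; apply: bwd_unique; first by rewrite /kerop/= PA Pv linear0.
  rewrite -iter_opSr vE.
  by have -> : n + k.+1%:Z = n + 1 + k%:Z by lia.
have [k|x Bx vx] := XB_geometric_series hB hB1 (u := fun k => v k.+1)
    (K := C * r * normXB B y) r01.
  have [By' <-] := XB_shift hB k.+1%:Z By.
  rewrite mulrAC -[C * r * _]mulrA -exprS.
  apply: XB_le => //; last by move=> n; exact: bwd_bound.
  by rewrite mulr_ge0 ?exprn_ge0 ?(ltW C0)//; case/andP: r01.
exists x => // n.
have sumS N : A n (\sum_(0 <= k < N.+1) v k.+1 n) =
    \sum_(0 <= k < N) v k.+1 (n + 1) + (y (n + 1) - P (n + 1) (y (n + 1))).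
  rewrite linear_sum; under eq_bigr do rewrite /= Av.
  rewrite big_nat_recl// addrC; congr (_ + _); rewrite /v addr0.
  by apply: bwd_unique => //; exact: kerop_compl.
have lhs := vx n; rewrite -cvg_shiftS in lhs.
have := opnormX_cvg (hA n) lhs => {}lhs; rewrite (funext sumS) in lhs.
apply: norm_cvg_unique lhs _.
by apply: cvgD; [exact: vx | exact: cvg_cst].
Qed.

Lemma dichotomy_solution (y : int -> X) : XB B y ->
  exists2 x, XB B x & forall n, x (n + 1) - A n (x n) = y (n + 1).
Proof.
move=> By.
have [s Bs sE] := stable_solution By; have [u Bu uE] := unstable_solution By.
exists (fun n => s n - u n) => [|n]; first exact: (XBB hB Bs Bu).1.
rewrite linearB/= sE uE opprB addrA (addrA _ (u _)) subrK addrACA subrr.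
by rewrite addr0 addrC addKr.
Qed.

End Dichotomy.

(** * The Green operator and Lipschitz perturbations *)

Section Perturbation.
Context {R : realType} (B : seq_space R) (X : completeNormedModType R).
Context (A : int -> {linear X -> X}).
Hypothesis hB : admissible B.
Hypothesis hB1 : seq_norm B (\1_[set (0 : int)]) = 1.
Hypothesis hA : forall m : int, (opnormX (A m) < +oo)%E.
Hypothesis hdich : exp_dichotomy A.

Lemma green_opP (y : int -> X) : XB B y ->
  XB B (green_op B A y) /\
  forall n, green_op B A y (n + 1) - A n (green_op B A y n) = y (n + 1).
Proof.
move=> By; case: hdich => P [PP PA kerA [C [lam [C0 lam0 fwdC bwdC]]]].
apply: (@xgetPex _ _
  [set x | XB B x /\ forall n, x (n + 1) - A n (x n) = y (n + 1)]).
have [x Bx xE] := dichotomy_solution hA PP PA kerA C0 lam0 fwdC bwdC hB hB1 By.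
by exists x.
Qed.

Lemma XB_trajectory_eq0 (x : int -> X) : XB B x -> trajectory A x ->
  x = fun=> 0.
Proof.
move=> Bx Ax; case: hdich => P [PP PA kerA [C [lam [C0 lam0 fwdC bwdC]]]].
apply/funext; apply: (bounded_trajectory_eq0 PP PA kerA C0 lam0 fwdC bwdC Ax).
by move=> n; exact: (normXB_eval hB hB1 n Bx).
Qed.

Lemma green_op_eq (x y : int -> X) : XB B x -> XB B y ->
  (forall n, x (n + 1) - A n (x n) = y (n + 1)) -> green_op B A y = x.
Proof.
move=> Bx By xE; have [Bg gE] := green_opP By.
have BD := (XBB hB Bg Bx).1.
have /XB_trajectory_eq0 : trajectory A (fun n => green_op B A y n - x n).
  move=> n; rewrite linearB/=.
  have -> : green_op B A y (n + 1) = y (n + 1) + A n (green_op B A y n).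
    by rewrite -gE subrK.
  have -> : x (n + 1) = y (n + 1) + A n (x n) by rewrite -xE subrK.
  by rewrite opprD addrACA subrr add0r.
move=> /(_ BD) /(congr1 (fun s => s _)) D0.
by apply/funext => n; apply/eqP; rewrite -subr_eq0; apply/eqP; exact: D0.
Qed.

Context (g : R).
Hypothesis gG : (opnormXB B (green_op B A) <= g%:E)%E.

Lemma normXB_green_op (y : int -> X) : XB B y ->
  normXB B (green_op B A y) <= g * normXB B y.
Proof.
apply: opnorm_bound gG.
- by move=> a v; exact: XBZ.
- by move=> v Bv v0; apply/funext => n; rewrite (normXB_eq0 hB Bv v0).
- exact: normXB_ge0.
- by move=> v /green_opP[].
move=> a v Bv; have [Bg gE] := green_opP Bv.
apply: green_op_eq; [exact: (XBZ hB a Bg).1 | exact: (XBZ hB a Bv).1 |].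
move=> n; rewrite -[RHS]/(a *: v (n + 1)) -gE scalerBr -linearZ.
by [].
Qed.

(** [z] is the Green operator applied to its own defect, once the defect is
    moved by one index. *)
Lemma normXB_le_defect (z h : int -> X) : XB B z -> XB B h ->
  (forall n, z (n + 1) - A n (z n) = h n) -> normXB B z <= g * normXB B h.
Proof.
move=> Bz Bh zE; have [Bh' <-] := XB_shift hB (- 1) Bh.
rewrite -(green_op_eq Bz Bh') ?normXB_green_op// => n.
by rewrite addrK.
Qed.

Context (c : R) (f : int -> X -> X).
Hypothesis c0 : 0 < c.
Hypothesis hf : forall (n : int) (x y : X), `|f n x - f n y| <= c * `|x - y|.
Hypotheses (g0 : 0 <= g) (cg1 : c * g < 1).

Let F n x := A n x + f n x.

(** The defect of [x - y] for the linear system is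
    [f n (x n) - f n (y n)] minus the error of [y], hence of norm at most
    [c * ||x - y||] plus that of the error. *)
Lemma shadowing_estimate (x y : int -> X) : trajectory F x ->
  XB B (fun n => y (n + 1) - F n (y n)) -> XB B (fun n => x n - y n) ->
  (1 - c * g) * normXB B (fun n => x n - y n) <=
    g * normXB B (fun n => y (n + 1) - F n (y n)).
Proof.
move=> Fx Be Bz.
have [Bf le_f] := XB_le hB (x := fun n => f n (x n) - f n (y n)) (ltW c0) Bz
  (fun n => hf n (x n) (y n)).
have [Bh le_h] := XBB hB Bf Be.
have := normXB_le_defect Bz Bh; rewrite mulrBl mul1r lerBlDr => le_z.
apply: le_trans (le_z _) _; last first.
  rewrite addrC (mulrC c) -mulrA -mulrDr ler_wpM2l//.
  by apply: le_trans le_h _; rewrite lerD2r.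
move=> n; rewrite Fx /F linearB/=.
rewrite opprB [in LHS]addrC !addrA subrK.
by rewrite opprB (addrC _ (f n (y n))) !addrA subrK (addrC (f n (x n))).
Qed.

Lemma trajectory_unique (x x' : int -> X) : trajectory F x -> trajectory F x' ->
  XB B (fun n => x n - x' n) -> x = x'.
Proof.
move=> Fx Fx' BD.
have defect0 : (fun n => x' (n + 1) - F n (x' n)) = fun=> 0.
  by apply/funext => n; rewrite Fx' subrr.
have := shadowing_estimate Fx _ BD; rewrite defect0 => /(_ (XB0 hB X)).
have -> : normXB B (fun=> 0 : X) = 0.
  have [_] := XBZ hB 0 (XB0 hB X); rewrite normr0 mul0r => <-.
  by congr (normXB _ _); apply/funext => n; rewrite scaler0.
rewrite mulr0 pmulr_rle0 ?subr_gt0// => D0.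
have {}D0 : normXB B (fun n => x n - x' n) = 0.
  by apply/eqP; rewrite eq_le D0 (normXB_ge0 hB BD).
apply/funext => n; apply/eqP; rewrite -subr_eq0.
by rewrite (normXB_eq0 hB BD D0).
Qed.

(** Picard iteration from 0 of the contraction [T]; the differences of
    consecutive iterates form a geometric series. *)
Lemma trajectory_near_pseudotrajectory (y : int -> X) :
  XB B (fun n => y (n + 1) - F n (y n)) ->
  exists2 x, trajectory F x & XB B (fun n => x n - y n).
Proof.
set e := fun n => _ => Be.
pose h z n := f n (y n + z n) - f n (y n) - e n.
have Bh z : XB B z -> XB B (h z).
  move=> Bz; apply: (XBB hB _ Be).1.
  apply: (XB_le hB (ltW c0) Bz _).1 => n.
  by apply: le_trans (hf _ _ _) _; rewrite addrAC subrr add0r.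
pose T z := green_op B A (fun n => h z (n - 1)).
have TP z : XB B z ->
    XB B (T z) /\ forall n, T z (n + 1) - A n (T z n) = h z n.
  move=> Bz; have [Bhz _] := XB_shift hB (- 1) (Bh z Bz).
  have [? E] := green_opP Bhz; split=> // n.
  by rewrite E addrK.
pose z k := iter k T (fun=> 0).
have Bz k : XB B (z k).
  by elim: k => [|k IH]; [exact: XB0 | exact: (TP _ IH).1].
have dz k : XB B (fun n => z k.+1 n - z k n) /\
    normXB B (fun n => z k.+1 n - z k n) <=
      normXB B (fun n => z 1%N n - z 0%N n) * (c * g) ^+ k.
  have [BD _] := XBB hB (Bz k.+1) (Bz k); split=> //.
  elim: k BD => [|k IH] BD; first by rewrite expr0 mulr1.
  have BD' := (XBB hB (Bz k.+1) (Bz k)).1.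
  have [Bhd le_hd] : XB B (fun n => h (z k.+1) n - h (z k) n) /\
      normXB B (fun n => h (z k.+1) n - h (z k) n) <=
        c * normXB B (fun n => z k.+1 n - z k n).
    apply: XB_le => //; first exact: ltW.
    move=> n; rewrite /h; move: (e n) => en.
    rewrite (opprB _ en) addrA subrK opprB addrA subrK.
    by apply: le_trans (hf _ _ _) _; rewrite opprD addrACA subrr add0r.
  apply: le_trans (normXB_le_defect BD Bhd _) _.
    move=> n; rewrite -(TP _ (Bz k.+1)).2 -(TP _ (Bz k)).2 linearB/=.
    by rewrite !opprD !opprK addrACA.
  apply: le_trans (ler_wpM2l g0 le_hd) _.
  have le_g := ler_wpM2l g0 (ler_wpM2l (ltW c0) (IH BD')).
  by apply: le_trans le_g _; rewrite exprS le_eqVlt; apply/orP; left;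
    apply/eqP; ring.
have cg01 : 0 <= c * g < 1 by rewrite cg1 mulr_ge0 ?(ltW c0).
have [zoo Bzoo z_cvg] := XB_geometric_series hB hB1 cg01 dz.
(* The series telescopes, and the first iterate vanishes. *)
have {}z_cvg n : z k n @[k --> \oo] --> zoo n.
  have := z_cvg n.
  under eq_fun do rewrite (telescope_sumr (fun k => z k n))//.
  by under eq_fun do rewrite subr0.
have zooE n : zoo (n + 1) = A n (zoo n) + h zoo n.
  have lhs := z_cvg (n + 1); rewrite -cvg_shiftS in lhs.
  apply: norm_cvg_unique lhs _.
  have -> : (fun k => z k.+1 (n + 1)) = (fun k => A n (z k.+1 n) + h (z k) n).
    by apply/funext => k; rewrite [RHS]addrC -(TP _ (Bz k)).2 subrK.
  have zS : z k.+1 n @[k --> \oo] --> zoo n.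
    by rewrite (cvg_shiftS (fun k => z k n)).
  apply: cvgD; first exact: opnormX_cvg zS.
  apply: cvgB; last exact: cvg_cst.
  apply: cvgB; last exact: cvg_cst.
  apply: (lipschitz_cvg (hf n)); apply: cvgD => //; exact: cvg_cst.
exists (fun n => y n + zoo n) => [n|].
  rewrite zooE /h /e /F (linearD (A n))/=.
  rewrite opprB (addrC (A n (y n)) (f n (y n))) !addrA subrK.
  by rewrite [LHS]addrC !addrA addNr add0r [LHS]addrC addrA.
have -> // : (fun n => y n + zoo n - y n) = zoo.
by apply/funext => n; rewrite addrAC subrr add0r.
Qed.

End Perturbation.

Theorem theorem4 (R : realType) (B : seq_space R) (X : completeNormedModType R)
    (A : int -> {linear X -> X}) (c : R) (f : int -> X -> X)
    (hB : admissible B)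
    (hB1 : seq_norm B (\1_[set (0 : int)]) = 1)
    (hA : forall m : int, (opnormX (A m) < +oo)%E)
    (hdich : exp_dichotomy A)
    (hc : 0 < c)
    (hf : forall (n : int) (x y : X), `|f n x - f n y| <= c * `|x - y|)
    (hG : (c%:E * opnormXB B (green_op B A) < 1)%E) :
  let F := fun (n : int) (x : X) => A n x + f n x in
  lipschitz_shadowing B F /\
  forall L : R, shadowing_constant B F L ->
    forall eps : R, 0 < eps ->
      forall y : int -> X, pseudotrajectory B F (L * eps) y ->
        exists! x : int -> X, shadows B F eps y x.
Proof.
move=> F.
(* The operator norm is extended-real valued: the hypothesis excludes +oo, and
   taking a real upper bound that is nonnegative covers the other values. *)
have [g [g0 gG cg1]] : exists g : R,
    [/\ 0 <= g, (opnormXB B (green_op B A) <= g%:E)%E & c * g < 1].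
  case: (opnormXB B (green_op B A)) hG => [k | | _].
  - rewrite -EFinM lte_fin => ck1; exists (Num.max 0 k).
    rewrite lee_fin !le_max !lexx orbT maxr_pMr ?(ltW hc)//.
    by rewrite gt_max mulr0 ltr01.
  - by rewrite gt0_muley ?lte_fin.
  - by exists 0; rewrite leNye mulr0.
have unique := trajectory_unique hB hB1 hA hdich gG hc hf g0 cg1.
split=> [|L [_ shadow] eps eps0 y yP]; last first.
  have [x xP] := shadow eps eps0 y yP; exists x; split=> // x' x'P.
  have [Fx Bx _] := xP; have [Fx' Bx' _] := x'P.
  apply: unique => //; have [BD _] := XBB hB Bx Bx'.
  move: BD; congr (XB _ _); apply/funext => n.
  by rewrite opprB addrA subrK.
have q0 : 0 < 1 - c * g by rewrite subr_gt0.
have g1 : 0 < g + 1 by rewrite ltr_wpDl.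
(* The estimate asks for a positive L with g * L <= 1 - c * g, also when
   g = 0: hence the denominator g + 1. *)
exists ((1 - c * g) / (g + 1)); split=> [|eps eps0 y [Be le_e]].
  exact: divr_gt0.
have [x Fx Bx] :=
  trajectory_near_pseudotrajectory hB hB1 hA hdich gG hc hf g0 cg1 Be.
exists x; split=> //.
have := shadowing_estimate hB hB1 hA hdich gG hc hf g0 Fx Be Bx.
rewrite -[_ <= eps](ler_pM2l q0) => /le_trans; apply.
apply: le_trans (ler_wpM2l g0 le_e) _.
rewrite mulrAC mulrA ler_pdivrMr// [leRHS]mulrC ler_wpM2r ?lerDl//.
by rewrite mulr_ge0 ?ltW.
Qed.
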